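(* Let $n$ be a positive integer, let $\mathbb{T}_n$ be the set of increasing tableaux of straight shape with all labels in $[n]=\{1,\dots,n\}$, and let $\mathcal{P}_{\mathrm{end}}$ be the set partition of $\mathbb{T}_n$ output by the algorithm described in the context. Then for all $T_1,T_2\in\mathbb{T}_n$, the tableaux $T_1$ and $T_2$ are $K$-Knuth equivalent if and only if $T_1$ and $T_2$ lie in a common set of the partition $\mathcal{P}_{\mathrm{end}}$.
   Context: Tableaux. $\mathbb{N}$ is the set of positive integers. A box is an element $(i,j)\in\mathbb{N}\times\mathbb{N}$ (row $i$, column $j$; rows are numbered downward). A straight shape is a finite $\lambda\subset\mathbb{N}\times\mathbb{N}$ such that whenever $(i,j)\in\lambda$, all $(i',j')$ with $i'\le i$, $j'\le j$ are in $\lambda$ (a Young diagram of a partition; the empty shape is allowed). An increasing tableau of straight shape $\lambda$ is a map $T:\lambda\to\mathbb{N}$ strictly increasing left to right along rows and down columns. Tableaux in $\mathbb{T}_n$ need not use every letter of $[n]$. Row word. $\mathrm{row}(T)$ is the word obtained by reading the entries of $T$ left to right along each row, starting from the bottom row and moving upward. $K$-Knuth equivalence. On words in $\mathbb{N}$, $\equiv$ is the equivalence relation generated by the following replacements of consecutive letters (in either direction): $xzy\equiv zxy$ $(x<y<z)$; $yxz\equiv yzx$ $(x<y<z)$; $x\equiv xx$; $xyx\equiv yxy$. Tableaux $T,T'$ are $K$-Knuth equivalent, $T\equiv T'$, if $\mathrm{row}(T)\equiv\mathrm{row}(T')$. Hecke insertion. To insert $x\in\mathbb{N}$ into a (possibly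 empty) row $R$ of a tableau: Suppose first $x\ge y$ for all $y\in R$. (1) If adjoining a box containing $x$ to the end of $R$ gives an increasing tableau, do so and stop. (2) Otherwise leave $R$ unchanged and stop. If not all entries of $R$ are $\le x$, let $y$ be the smallest entry of $R$ strictly larger than $x$. (3) If replacing $y$ by $x$ gives an increasing tableau, replace $y$ by $x$ and insert $y$ into the next row. (4) Otherwise leave $R$ unchanged and insert $y$ into the next row. $T\leftarrow x$ is the result of inserting $x$ into the first row of $T$ and continuing until the procedure stops. For a word $a=a_1\cdots a_k$, $T\leftarrow a$ denotes $(\cdots((T\leftarrow a_1)\leftarrow a_2)\cdots\leftarrow a_k)$. Primitive pairs. A pair $(a,b)$ of words with letters in $[n]$ is primitive if one of the following holds: $a=p$, $b=pp$ for a letter $p$; $a=pqp$, $b=qpq$ for letters $p\ne q$; $a=xzy$, $b=zxy$ for letters $x<y<z$; $a=yxz$, $b=yzx$ for letters $x<y<z$. The algorithm. It maintains a set partition $\mathcal{P}$ of $\mathbb{T}_n$ and a queue $Q$ of unordered pairs of tableaux in $\mathbb{T}_n$. Two tableaux are said to be joined by $\mathcal{P}$ if they lie in a common set of $\mathcal{P}$. Initially $\mathcal{P}=\{\{T\}:T\in\mathbb{T}_n\}$ and $Q$ is empty. Stage 1: for every $T\in\mathbb{T}_n$ and every primitive pair $(a,b)$ (in some order), compute $T_1=T\leftarrow a$ and $T_2=T\leftarrow b$; if $T_1$ and $T_2$ are not joined by $\mathcal{P}$, merge the sets of $\mathcal{P}$ containing $T_1$ and $T_2$, and insert $\{T_1,T_2\}$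 into $Q$. Stage 2: while $Q$ is non-empty, remove a pair $\{U_1,U_2\}$ from $Q$, and for each $1\le y\le n$ compute $T_1=U_1\leftarrow y$ and $T_2=U_2\leftarrow y$; if $T_1$ and $T_2$ are not joined by $\mathcal{P}$, merge the sets of $\mathcal{P}$ containing $T_1$ and $T_2$, and insert $\{T_1,T_2\}$ into $Q$. When $Q$ is empty, output $\mathcal{P}$; this final partition is $\mathcal{P}_{\mathrm{end}}$. *)

(* Defs.v *)
From HB Require Import structures.
From Stdlib Require Import Relation_Operators.
From mathcomp Require Export all_boot.
Set Implicit Arguments.
Unset Strict Implicit.
Unset Printing Implicit Defensive.

(* A filling of a straight shape is the list of its rows, from top to bottom,
   each row being listed from left to right.  Rows are required to be nonempty,
   so every tableau has exactly one representation; the empty tableau is [::]. *)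
Definition row_above (R S : seq nat) : bool :=
  (size S <= size R) && all (fun p => p.1 < p.2) (zip R S).

Definition increasing_tableau (T : seq (seq nat)) : bool :=
  [&& [::] \notin T, all (all (leq 1)) T, all (sorted ltn) T
    & sorted row_above T].

Definition row_word (T : seq (seq nat)) : seq nat := flatten (rev T).

(* Each move preserves the set of letters of a word, so a word with positive
   letters is only equivalent to words with positive letters. *)
Variant K_Knuth_move : seq nat -> seq nat -> Prop :=
| KK_xzy u v x y z of x < y & y < z :
    K_Knuth_move (u ++ [:: x; z; y] ++ v) (u ++ [:: z; x; y] ++ v)
| KK_yxz u v x y z of x < y & y < z :
    K_Knuth_move (u ++ [:: y; x; z] ++ v) (u ++ [:: y; z; x] ++ v)
| KK_xx u v x :
    K_Knuth_move (u ++ [:: x] ++ v) (u ++ [:: x; x] ++ v)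
| KK_xyx u v x y :
    K_Knuth_move (u ++ [:: x; y; x] ++ v) (u ++ [:: y; x; y] ++ v).

Definition K_Knuth_equiv : seq nat -> seq nat -> Prop :=
  clos_refl_sym_trans (seq nat) K_Knuth_move.

Definition K_Knuth_equiv_tab (T1 T2 : seq (seq nat)) : Prop :=
  K_Knuth_equiv (row_word T1) (row_word T2).

(* [hecke_from U D x] inserts x into the first row of D inside the tableau
   U ++ D; when D = [::] this is the empty row below U.  As rows are strictly
   increasing, the first entry of R larger than x, at index [find (ltn x) R],
   is also the smallest one. *)
Fixpoint hecke_from (U D : seq (seq nat)) (x : nat) : seq (seq nat) :=
  match D with
  | [::] =>
      if increasing_tableau (rcons U [:: x]) then rcons U [:: x] else U
  | R :: D' =>
      if all (fun y => y <= x) R then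
        if increasing_tableau (U ++ rcons R x :: D')
        then U ++ rcons R x :: D'
        else U ++ R :: D'
      else
        let k := find (ltn x) R in
        let y := nth 0 R k in
        let R' := set_nth 0 R k x in
        if increasing_tableau (U ++ R' :: D')
        then hecke_from (rcons U R') D' y
        else hecke_from (rcons U R) D' y
  end.

Definition hecke_insert (T : seq (seq nat)) (x : nat) : seq (seq nat) :=
  hecke_from [::] T x.

(* [letter n] is [n] = {1, ..., n}, and [tab n] is T_n. *)
Record letter (n : nat) : Type := Letter {
  letter_val :> 'I_n.+1;
  letter_gt0 : 0 < letter_val }.

HB.instance Definition _ n := [isSub for @letter_val n].
HB.instance Definition _ n := [Finite of letter n by <:].

Definition labels_le (n : nat) (T : seq (seq nat)) : bool :=
  all (all (fun x => x <= n)) T.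

Record tab (n : nat) : Type := Tab {
  rows :> seq (seq nat);
  rowsP : increasing_tableau rows && labels_le n rows }.

HB.instance Definition _ n := [isSub for @rows n].
HB.instance Definition _ n := [Countable of tab n by <:].

Section TabFinite.
Variable n : nat.

Let enc_row (R : seq nat) : n.-bseq 'I_n.+1 :=
  insub_bseq n [seq inord x | x <- R].
Let enc (T : tab n) : n.-bseq (n.-bseq 'I_n.+1) :=
  insub_bseq n [seq enc_row R | R <- rows T].
Let dec (B : n.-bseq (n.-bseq 'I_n.+1)) : option (tab n) :=
  insub [seq [seq val i | i <- val r] | r <- val B].

Lemma size_sorted_letters (s : seq nat) :
  sorted ltn s -> all (leq 1) s -> all (fun x => x <= n) s -> size s <= n.
Proof.
move=> ss s1 sn; rewrite -[leqRHS](size_iota 1).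
apply: uniq_leq_size => [|x xs]; first exact: sorted_uniq ltn_trans ltnn _ ss.
by rewrite mem_iota add1n ltnS (allP s1 _ xs) (allP sn _ xs).
Qed.

Lemma size_tab (T : tab n) : size (rows T) <= n.
Proof.
case: T => T /= /andP[/and4P[T0 T1 _ Tc] Tn].
rewrite -(size_map (head 0)); apply: size_sorted_letters.
- elim: T T0 Tc {T1 Tn} => [|R [|S T] IH] //=.
  rewrite !inE !negb_or => /and3P[R0 S0 T0] /andP[RS ST].
  move: IH; rewrite /= inE negb_or S0 T0 => /(_ isT ST) ->; rewrite andbT.
  by case: R S R0 S0 RS {ST} => [|a R] [|b S] //= _ _ /and3P[].
- apply/allP => _ /mapP[R RT ->]; move/allP/(_ R RT): T1.
  by case: R RT => [R0|a R _ /andP[]//]; rewrite R0 in T0.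
- apply/allP => _ /mapP[R RT ->]; move/allP/(_ R RT): Tn.
  by case: R RT => [R0|a R _ /andP[]//]; rewrite R0 in T0.
Qed.

Fact tab_encK : pcancel enc dec.
Proof.
move=> T; rewrite /dec /enc /insub_bseq val_insubd size_map size_tab.
suff -> : [seq [seq val i | i <- val r] | r <- [seq enc_row R | R <- rows T]]
          = rows T by exact: valK.
rewrite -map_comp -[RHS]map_id; apply/eq_in_map => R RT /=.
case/andP: (rowsP T) => /and4P[_ /allP/(_ R RT) R1 /allP/(_ R RT) Rs _].
move=> /allP/(_ R RT) Rn.
rewrite /enc_row /insub_bseq val_insubd size_map size_sorted_letters //.
rewrite -map_comp -[RHS]map_id; apply/eq_in_map => x xR /=.
by rewrite inordK // ltnS (allP Rn).
Qed.

HB.instance Definition _ : isFinite (tab n) := PCanIsFinite tab_encK.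

End TabFinite.

Lemma hecke_from_increasing U D x :
  increasing_tableau (U ++ D) -> increasing_tableau (hecke_from U D x).
Proof.
elim: D U x => [|R D IH] U x UD /=; first by case: ifP => //; rewrite -[U]cats0.
case: ifP => _; first by case: ifP.
by case: ifP => H; apply: IH; rewrite cat_rcons.
Qed.

Lemma hecke_from_labels n U D x :
  labels_le n (U ++ D) -> x <= n -> labels_le n (hecke_from U D x).
Proof.
rewrite /labels_le; elim: D U x => [|R D IH] U x /=.
  rewrite cats0 => Un xn; case: ifP => // _.
  by rewrite all_rcons /= xn Un.
rewrite all_cat /= => /and3P[Un Rn Dn] xn.
case: ifP => [_|/negbT].
  by case: ifP => _; rewrite all_cat /= ?all_rcons ?xn Un Rn Dn.
rewrite -has_predC => hR; have {}hR : has (ltn x) R.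
  by apply: sub_has hR => y /=; rewrite -ltnNge.
have yn : nth 0 R (find (ltn x) R) <= n.
  by rewrite (allP Rn) // mem_nth // -has_find.
have R'n : all (fun y => y <= n) (set_nth 0 R (find (ltn x) R) x).
  apply/allP => y /(nthP 0)[i _ <-]; rewrite nth_set_nth /=.
  case: eqP => // _; case: (ltnP i (size R)) => iR; last by rewrite nth_default.
  by rewrite (allP Rn) // mem_nth.
by case: ifP => _; apply: IH; rewrite // cat_rcons all_cat /= ?R'n ?Rn Un Dn.
Qed.

Fact tab_insert_subproof n (T : tab n) (x : letter n) :
  increasing_tableau (hecke_insert T x) && labels_le n (hecke_insert T x).
Proof.
case/andP: (rowsP T) => T1 T2.
by rewrite hecke_from_increasing // hecke_from_labels // -ltnS ltn_ord.
Qed.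

Definition tab_insert n (T : tab n) (x : letter n) : tab n :=
  Tab (tab_insert_subproof T x).

Definition tab_insert_word n (T : tab n) (w : seq (letter n)) : tab n :=
  foldl (@tab_insert n) T w.

Variant primitive_pair (n : nat) : seq (letter n) -> seq (letter n) -> Prop :=
| Prim_pp (p : letter n) :
    primitive_pair [:: p] [:: p; p]
| Prim_pqp (p q : letter n) of p != q :
    primitive_pair [:: p; q; p] [:: q; p; q]
| Prim_xzy (x y z : letter n) of x < y & y < z :
    primitive_pair [:: x; z; y] [:: z; x; y]
| Prim_yxz (x y z : letter n) of x < y & y < z :
    primitive_pair [:: y; x; z] [:: y; z; x].

Definition joined n (P : {set {set tab n}}) (T1 T2 : tab n) : bool :=
  [exists B in P, (T1 \in B) && (T2 \in B)].

Definition merge_blocks n (P : {set {set tab n}}) (T1 T2 : tab n) :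
    {set {set tab n}} :=
  (pblock P T1 :|: pblock P T2) |: (P :\: [set pblock P T1; pblock P T2]).

(* The current partition and the queue.  A queued unordered pair is stored as
   an ordered one: [joined] and [merge_blocks] are symmetric in T1 and T2, so
   the order is irrelevant. *)
Definition state (n : nat) : Type :=
  ({set {set tab n}} * seq (tab n * tab n))%type.

Definition process n (s : state n) (p : tab n * tab n) : state n :=
  if joined s.1 p.1 p.2 then s
  else (merge_blocks s.1 p.1 p.2, rcons s.2 p).

Definition initial_state n : state n := ([set [set T] | T : tab n], [::]).

(* A possible order in which the first stage treats its data (T, (a, b)). *)
Definition stage1_order n
    (o : seq (tab n * (seq (letter n) * seq (letter n)))) : Prop :=
  uniq o /\ forall T a b, (T, (a, b)) \in o <-> primitive_pair a b.

Definition stage1 n (o : seq (tab n * (seq (letter n) * seq (letter n)))) :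
    state n :=
  foldl (@process n) (initial_state n)
    [seq (tab_insert_word t.1 t.2.1, tab_insert_word t.1 t.2.2) | t <- o].

Definition insert_letters n (U : tab n * tab n) (ys : seq (letter n)) :
    seq (tab n * tab n) :=
  [seq (tab_insert U.1 y, tab_insert U.2 y) | y <- ys].

(* [stage2 s P]: some execution of the second stage from the state s ends with
   the partition P.  Any queued pair may be removed (in particular the oldest
   one), and the letters may be treated in any order. *)
Inductive stage2 n : state n -> {set {set tab n}} -> Prop :=
| Stage2_stop P : stage2 (P, [::]) P
| Stage2_step P Q U Q' ys Pend
    of perm_eq Q (U :: Q') & perm_eq ys (enum {: letter n})
     & stage2 (foldl (@process n) (P, Q') (insert_letters U ys)) Pend :
    stage2 (P, Q) Pend.

Definition algorithm_output n (Pend : {set {set tab n}}) : Prop :=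
  exists2 o, stage1_order o & stage2 (stage1 o) Pend.

Lemma stage1_order_exists n : exists o, @stage1_order n o.
Proof.
pose L := letter n; pose E := enum {: L * L * L}.
pose l1 := [seq ([:: p], [:: p; p]) | p <- enum {: L}].
pose l2 := [seq ([:: t.1.1; t.1.2; t.1.1], [:: t.1.2; t.1.1; t.1.2])
           | t : L * L * L <- E & t.1.1 != t.1.2].
pose l3 := [seq ([:: t.1.1; t.2; t.1.2], [:: t.2; t.1.1; t.1.2])
           | t : L * L * L <- E & (t.1.1 < t.1.2) && (t.1.2 < t.2)].
pose l4 := [seq ([:: t.1.2; t.1.1; t.2], [:: t.1.2; t.2; t.1.1])
           | t : L * L * L <- E & (t.1.1 < t.1.2) && (t.1.2 < t.2)].
pose l := l1 ++ l2 ++ l3 ++ l4.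
exists (undup [seq (T, w) | T <- enum {: tab n}, w <- l]); split=> [|T a b].
  exact: undup_uniq.
rewrite mem_undup; apply: (iff_trans (B := (a, b) \in l)).
  split=> [/allpairsP[[T' w] /= [_ wl [_ ->]]] //|abl].
  by apply/allpairsP; exists (T, (a, b)); rewrite mem_enum.
rewrite !mem_cat; split.
  case/or4P => /mapP[].
  - by move=> p _ [-> ->]; exact: Prim_pp.
  - by move=> t; rewrite mem_filter => /andP[h _] [-> ->]; exact: Prim_pqp.
  - by move=> t; rewrite mem_filter => /andP[/andP[h h'] _] [-> ->]; exact: Prim_xzy.
  - by move=> t; rewrite mem_filter => /andP[/andP[h h'] _] [-> ->]; exact: Prim_yxz.
case=> [p|p q pq|x y z xy yz|x y z xy yz]; apply/or4P.
- by apply: Or41; apply/mapP; exists p; rewrite ?mem_enum.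
- apply: Or42; apply/mapP; exists (p, q, q) => //.
  by rewrite mem_filter /= pq mem_enum.
- apply: Or43; apply/mapP; exists (x, y, z) => //.
  by rewrite mem_filter /= xy yz mem_enum.
- apply: Or44; apply/mapP; exists (x, y, z) => //.
  by rewrite mem_filter /= xy yz mem_enum.
Qed.

Lemma process_measure n (s : state n) p :
  cover s.1 = [set: tab n] ->
  cover (process s p).1 = [set: tab n] /\
  #|(process s p).1| + size (process s p).2 <= #|s.1| + size s.2.
Proof.
case: s p => P Q [T1 T2] /= cP; rewrite /process /=; case: ifP => //= /negbT nj.
have inP T : T \in pblock P T by rewrite mem_pblock cP inE.
have PB T : pblock P T \in P by rewrite pblock_mem // cP inE.
have neq : pblock P T1 != pblock P T2.
  apply: contra nj => /eqP e; apply/existsP; exists (pblock P T1).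
  by rewrite PB inP {1}e inP.
split.
  apply/setP => T; rewrite inE; apply/bigcupP.
  case: (boolP (pblock P T \in [set pblock P T1; pblock P T2])) => h.
    exists (pblock P T1 :|: pblock P T2); first exact: setU11.
    by move: h (inP T); rewrite !inE => /orP[]/eqP-> ->; rewrite ?orbT.
  by exists (pblock P T); rewrite // !in_setU1 in_setD h PB orbT.
rewrite size_rcons -addSnnS leq_add2r.
have -> : #|P| = (#|P :\: [set pblock P T1; pblock P T2]|).+2.
  rewrite -(cardsID [set pblock P T1; pblock P T2] P).
  by rewrite (setIidPr _) ?cards2 ?neq // subUset !sub1set !PB.
by rewrite ltnS cardsU1; case: (_ \notin _).
Qed.

Lemma foldl_process_measure n (s : state n) l :
  cover s.1 = [set: tab n] ->
  cover (foldl (@process n) s l).1 = [set: tab n] /\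
  #|(foldl (@process n) s l).1| + size (foldl (@process n) s l).2
    <= #|s.1| + size s.2.
Proof.
elim: l s => [|p l IH] s cs //=.
have [c1 le1] := process_measure p cs; have [c2 le2] := IH _ c1.
by split=> //; exact: leq_trans le2 le1.
Qed.

Lemma algorithm_output_exists n : exists Pend, @algorithm_output n Pend.
Proof.
have [o ho] := stage1_order_exists n.
suff [P hP] : exists P, stage2 (stage1 o) P by exists P, o.
have : cover (stage1 o).1 = [set: tab n].
  apply: (foldl_process_measure _ _).1; apply/setP => T; rewrite inE.
  by apply/bigcupP; exists [set T]; rewrite ?set11 ?imset_f.
move: {o ho}(stage1 o) => s; have [m] := ubnP (#|s.1| + size s.2).
elim: m s => // m IH [P [|U Q]] /= lem cP; first by exists P; constructor.
have [c le] := @foldl_process_measure _ (P, Q) (insert_letters U (enum {: letter n})) cP.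
case: (IH _ _ c) => [|P' hP'].
  by apply: leq_ltn_trans le _; move: lem; rewrite /= addnS.
by exists P'; apply: Stage2_step hP'.
Qed.

(* Main.v *)
(** Two facts about Hecke insertion reduce the theorem to bookkeeping on set
    partitions: row(T <- x) is K-Knuth equivalent to row(T) x, and inserting
    row(T) into the empty tableau gives back T.  By the first fact the algorithm
    only merges equivalent tableaux.  Conversely, the final relation "joined" is
    stable under insertion of a letter, because it is generated by pairs that
    all went through the queue; so it contains (0 <- u a v, 0 <- u b v) for every
    primitive pair (a, b), hence (0 <- w, 0 <- w') for all equivalent words w, w'
    in [n], and the second fact applies to w = row(T1), w' = row(T2).

    The first fact is proved row by row.  The only case which is not local to
    the current row is when x was bumped out of an unchanged row A0 x B0 and
    meets A y B with y right below x: then x may not replace y.  The needed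
    equivalence is obtained by reading the columns of A0 over A one by one. *)
From Stdlib Require Import Relation_Operators Setoid Morphisms.
Require Import Defs.
Set Implicit Arguments.
Unset Strict Implicit.
Unset Printing Implicit Defensive.

Local Infix "==k" := K_Knuth_equiv (at level 70).

(** * K-Knuth equivalence as a congruence on words *)

#[local] Instance K_Knuth_equivalence : Equivalence K_Knuth_equiv.
Proof.
split; first by move=> s; apply: rst_refl.
- by move=> s t; apply: rst_sym.
- by move=> s t w; apply: rst_trans.
Qed.

#[local] Hint Extern 0 (K_Knuth_equiv _ _) => reflexivity : core.

Lemma K_Knuth_equiv_in_context u v s t : s ==k t -> u ++ s ++ v ==k u ++ t ++ v.
Proof.
elim=> {s t} [s t|s|s t _|s t w _ IH1 _ IH2]; last exact: rst_trans IH1 IH2.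
- case=> {s t} => [u' v' x y z xy yz|u' v' x y z xy yz|u' v' x|u' v' x y];
    rewrite -!catA; rewrite ![u ++ u' ++ _]catA; apply: rst_step.
  + exact: KK_xzy.
  + exact: KK_yxz.
  + exact: KK_xx.
  + exact: KK_xyx.
- exact: rst_refl.
- exact: rst_sym.
Qed.

#[local] Instance cat_K_Knuth :
  Proper (K_Knuth_equiv ==> K_Knuth_equiv ==> K_Knuth_equiv) cat.
Proof.
move=> s s' ss t t' tt; transitivity (s' ++ t).
  exact: (K_Knuth_equiv_in_context [::]).
by have := K_Knuth_equiv_in_context s' [::] tt; rewrite !cats0.
Qed.

#[local] Instance cons_K_Knuth x :
  Proper (K_Knuth_equiv ==> K_Knuth_equiv) (cons x).
Proof. by move=> s t st; exact: (cat_K_Knuth (rst_refl _ _ [:: x]) st). Qed.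

Lemma sorted_ltn_cat A B :
  sorted ltn (A ++ B) = [&& allrel ltn A B, sorted ltn A & sorted ltn B].
Proof. by rewrite !(sorted_pairwise ltn_trans) pairwise_cat. Qed.

Lemma sorted_ltn_rcons A x :
  sorted ltn (rcons A x) = all (gtn x) A && sorted ltn A.
Proof. by rewrite !(sorted_pairwise ltn_trans) pairwise_rcons. Qed.

(** * Words *)

Section Words.
Implicit Types (x y z a b : nat) (s A B C : seq nat) (p : seq (nat * nat)).

Lemma kk_xzy x y z s : x < y -> y < z -> x :: z :: y :: s ==k z :: x :: y :: s.
Proof. by move=> xy yz; apply: rst_step; apply: (KK_xzy [::] s xy yz). Qed.

Lemma kk_yxz x y z s : x < y -> y < z -> y :: x :: z :: s ==k y :: z :: x :: s.
Proof. by move=> xy yz; apply: rst_step; apply: (KK_yxz [::] s xy yz). Qed.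

Lemma kk_xx x s : x :: x :: s ==k x :: s.
Proof. by apply: rst_sym; apply: rst_step; apply: (KK_xx [::] s x). Qed.

Lemma kk_xyx x y s : x :: y :: x :: s ==k y :: x :: y :: s.
Proof. by apply: rst_step; apply: (KK_xyx [::] s x y). Qed.

(** x crosses the letters of B from the right; the [kk_yxz] move past each of them uses its left
    neighbour as middle letter, y for the first one. *)
Lemma bump_right x y B s :
  x < y -> path ltn y B -> y :: B ++ x :: s ==k y :: x :: B ++ s.
Proof.
elim: B y => //= b B IH y xy /andP[yb Bb].
by rewrite (IH b (ltn_trans xy yb) Bb) (kk_yxz _ xy yb).
Qed.

(** Mirror image: y crosses A leftwards by [kk_xzy], the middle letter being the right neighbour of
    the letter crossed. *)
Lemma bump_left x y A s :
  sorted ltn (rcons A x) -> x < y -> A ++ y :: x :: s ==k y :: A ++ x :: s.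
Proof.
case: A => //= a A; elim: A a => [|b A IH] a /= /andP[ax Ax] xy.
  by rewrite kk_xzy.
have := Ax; rewrite (path_sortedE ltn_trans) all_rcons.
case/andP=> /andP[bx _] _.
by rewrite (IH b) // kk_xzy // (ltn_trans bx).
Qed.

(** A pair is a column of two adjacent rows, upper entry first; each column is read from bottom to
    top. *)
Definition column_word p := flatten [seq [:: c.2; c.1] | c <- p].

(** By [bump_right], each upper entry slides left until it stands next to the lower entry of its own
    column. *)
Lemma column_reading p C s :
  sorted ltn (unzip2 p ++ C) -> all (fun c => c.1 < c.2) p ->
  unzip2 p ++ C ++ unzip1 p ++ s ==k column_word p ++ C ++ s.
Proof.
elim: p => //= -[b a] p IH /= pC /andP[ba pp].
by rewrite catA bump_right // -catA IH // (path_sorted pC).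
Qed.

(** The next column acts as a catalyst: c moves left past b to let y pass a, goes back thanks to d,
    and then a lets y pass b. *)
Lemma column_pass y a b c d s : b < a -> a < c -> b < d -> d < c -> c < y ->
  y :: a :: b :: c :: d :: s ==k a :: b :: y :: c :: d :: s.
Proof.
move=> ba ac bd dc cy.
rewrite (kk_yxz _ ba ac) -(kk_xzy _ ac cy) -(kk_xzy _ bd dc).
by rewrite (kk_yxz _ ba (ltn_trans ac cy)).
Qed.

(** The leading y travels by [column_pass] to the last column a b, where y a y turns into a y a and
    the extra a is absorbed. *)
Lemma absorb_over_columns x y p s :
  x < y -> sorted ltn (rcons (unzip1 p) x) -> sorted ltn (rcons (unzip2 p) x) ->
  all (fun c => c.1 < c.2) p ->
  y :: column_word p ++ y :: x :: s ==k y :: column_word p ++ x :: s.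
Proof.
move=> xy; elim: p => [|[b a] p IH] /=; first by rewrite kk_xx.
case: p IH => [|[d c] p] IH /=.
  rewrite !andbT => bx ax ba; have ay := ltn_trans ax xy.
  by rewrite (kk_yxz _ ba ay) kk_xyx !(kk_yxz _ ba ax) -!(kk_xzy _ ax xy) kk_xx.
move=> /andP[bd d1] /andP[ac c2] /and3P[ba dc pp].
have := c2; rewrite (path_sortedE ltn_trans) all_rcons.
case/andP=> /andP[cx _] _.
have cy := ltn_trans cx xy.
rewrite !(column_pass _ ba ac bd dc cy).
by rewrite IH //= dc.
Qed.

(** The last x moves left until x b x appears, b being the first letter of B; this becomes b x b,
    and the y in front makes the two b adjacent. *)
Lemma absorb_over_row x y B s :
  x < y -> path ltn y B -> y :: x :: B ++ x :: s ==k y :: x :: B ++ s.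
Proof.
case: B => [|b B] xy /=; first by rewrite kk_xx.
case/andP=> yb bB; have xb := ltn_trans xy yb.
rewrite bump_right // kk_xyx.
by rewrite -(kk_yxz _ xy yb) kk_xx.
Qed.

Lemma bump_row x y A B s :
  sorted ltn (A ++ y :: B) -> all (gtn x) A -> x < y ->
  A ++ y :: B ++ x :: s ==k y :: A ++ x :: B ++ s.
Proof.
rewrite sorted_ltn_cat => /and3P[_ sA sB] Ax xy.
by rewrite (bump_right _ xy sB) bump_left // sorted_ltn_rcons Ax.
Qed.

(** Here the row blocks itself: it already contains x just before y. *)
Lemma bump_row_containing x y A B s :
  sorted ltn (rcons A x ++ y :: B) ->
  rcons A x ++ y :: B ++ x :: s ==k y :: rcons A x ++ y :: B ++ s.
Proof.
rewrite !cat_rcons sorted_ltn_cat allrel_consr.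
case/and3P=> /andP[Ax _] sA /= /andP[xy sB].
by rewrite (bump_right _ xy sB) kk_xyx bump_left // sorted_ltn_rcons Ax.
Qed.

(* The rows A0 x .. and A y .. (or just A) are consecutive, with y below x. *)
Section BlockedRows.
Variables (A0 A : seq nat) (x : nat).
Hypotheses (size_A : size A = size A0) (A0_lt_A : all (fun c => c.1 < c.2) (zip A0 A)).
Hypothesis (A0_lt_x : sorted ltn (rcons A0 x)) (A_lt_x : sorted ltn (rcons A x)).

Lemma unzip1_A0A : unzip1 (zip A0 A) = A0.
Proof. by rewrite unzip1_zip // size_A. Qed.
Lemma unzip2_A0A : unzip2 (zip A0 A) = A.
Proof. by rewrite unzip2_zip // size_A. Qed.

Lemma rows_to_columns C s : sorted ltn (A ++ C) ->
  A ++ C ++ A0 ++ s ==k column_word (zip A0 A) ++ C ++ s.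
Proof.
by move=> sAC; rewrite -column_reading ?unzip2_A0A // unzip1_A0A.
Qed.

(** Reading the columns of A0 over A puts the two letters x side by side. *)
Lemma blocked_append s : rcons A x ++ A0 ++ x :: s ==k A ++ A0 ++ x :: s.
Proof.
rewrite -cats1 -catA rows_to_columns ?cats1 //= kk_xx.
rewrite -[X in A ++ X]cat0s [X in _ ==k X]rows_to_columns //.
by rewrite cats0; move: A_lt_x; rewrite sorted_ltn_rcons => /andP[].
Qed.

Lemma blocked_bump y B s : sorted ltn (A ++ y :: B) -> x < y ->
  A ++ y :: B ++ x :: A0 ++ x :: s ==k y :: A ++ y :: B ++ A0 ++ x :: s.
Proof.
move=> sAyB xy; have := sAyB; rewrite sorted_ltn_cat allrel_consr.
case/and3P=> /andP[_ AB] sA syB.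
have /andP[Ax _] : all (gtn x) A && sorted ltn A by rewrite -sorted_ltn_rcons.
have sAxB : sorted ltn (A ++ x :: B).
  by rewrite sorted_ltn_cat allrel_consr Ax AB sA /= (path_le ltn_trans xy).
rewrite bump_row //.
rewrite (rows_to_columns (C := x :: B)) // (rows_to_columns (C := y :: B)) //=.
rewrite (bump_right _ xy syB).
have absorb t : y :: column_word (zip A0 A) ++ y :: x :: t ==k
                y :: column_word (zip A0 A) ++ x :: t.
  by apply: absorb_over_columns; rewrite ?unzip1_A0A ?unzip2_A0A.
(* The leading y lends a copy of itself in front of x, because [absorb_over_row] works on the
   pattern y x B x. *)
by rewrite -(absorb (B ++ _)) absorb_over_row // absorb.
Qed.
End BlockedRows.
End Words.

(** * Hecke insertion *)

Section Shapes.
Implicit Types (R S A B C : seq nat) (U D : seq (seq nat)).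

Definition above_ok U R := (U == [::]) || row_above (last [::] U) R.

Lemma row_above_cons a R b S :
  row_above (a :: R) (b :: S) = (a < b) && row_above R S.
Proof. by rewrite /row_above /= ltnS andbCA. Qed.

Lemma row_above_nil R : row_above R [::].
Proof. by case: R. Qed.

Lemma row_above_nth k R S :
  row_above R S -> k < size S -> nth 0 R k < nth 0 S k.
Proof.
elim: k R S => [|k IH] [|r R] [|s S] //; rewrite row_above_cons => /andP[] //.
by move=> _; apply: IH.
Qed.

Lemma increasing_cons R D :
  increasing_tableau (R :: D) =
  [&& R != [::], all (leq 1) R, sorted ltn R, row_above R (head [::] D)
    & increasing_tableau D].
Proof.
rewrite /increasing_tableau inE negb_or /= eq_sym.
rewrite (_ : path _ R D = row_above R (head [::] D) && sorted row_above D).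
  case: (R != [::]); case: (all (leq 1) R); case: (sorted ltn R);
  by case: (row_above _ _); rewrite /= ?andbF.
by case: D => //=; rewrite row_above_nil.
Qed.

Lemma increasing_cat_cons U R D :
  increasing_tableau (U ++ R :: D) =
  [&& increasing_tableau U, above_ok U R & increasing_tableau (R :: D)].
Proof.
rewrite /increasing_tableau mem_cat negb_or !all_cat.
rewrite (_ : sorted _ (U ++ _) =
             [&& sorted row_above U, above_ok U R & sorted row_above (R :: D)]).
  case: ([::] \notin U); case: ([::] \notin R :: D); case: (all (all _) U);
  case: (all (all _) (R :: D)); case: (all (sorted _) U);
  case: (all (sorted _) (R :: D)); case: (sorted _ U); case: above_ok; by rewrite ?andbF.
by case: U => //= S U; rewrite cat_path.
Qed.

(** With [behead C], replacing the first letter of C and, for empty C, appending x become one case.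
    The row below never obstructs, since x is smaller than any entry it replaces. *)
Lemma increasing_behead A C D x :
  increasing_tableau ((A ++ C) :: D) -> 0 < x -> all (gtn x) A -> all (ltn x) C ->
  increasing_tableau ((A ++ x :: behead C) :: D).
Proof.
rewrite !increasing_cons !all_cat !sorted_ltn_cat.
case/and5P=> _ /andP[-> C1] /and3P[AC -> sC] ADR ->.
move=> x0 Ax xC; rewrite /= x0 andbT; apply/and4P; split.
- by case: A {ADR Ax AC}.
- by case: C C1 {AC sC ADR xC} => //= c C /andP[].
- rewrite allrel_consr Ax /=; apply/andP; split.
    by case: C AC {C1 sC ADR xC} => //= c C; rewrite allrel_consr => /andP[].
  by case: C sC xC {C1 AC ADR} => //= c C cC /andP[xc _]; exact: (path_le ltn_trans xc cC).
- elim: A (head [::] D) ADR {Ax AC} => [|a A IH] [|d S] //=; rewrite ?row_above_cons.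
    case: C xC {C1 sC} => //= c C /andP[xc _].
    by rewrite !row_above_cons => /andP[cd ->]; rewrite (ltn_trans xc).
  by case/andP=> -> /IH.
Qed.

(** The entry above the new x lies in A0, hence is less than x, or is c. So the only obstruction is
    c = x in that very column. *)
Lemma row_above_behead A A0 C c B0 x :
  row_above (A0 ++ c :: B0) (A ++ C) -> size A <= size A0 ->
  all (gtn x) A0 -> c <= x ->
  row_above (A0 ++ c :: B0) (A ++ x :: behead C) \/ c = x /\ size A = size A0.
Proof.
elim: A A0 => [|a A IH] [|a0 A0] //=.
- move=> RC _ _; rewrite leq_eqVlt row_above_cons.
  case/predU1P=> [->|->]; first by right.
  left; case: C RC => [|d C] /=; rewrite ?row_above_nil // row_above_cons.
  by case/andP.
- rewrite row_above_cons => RC _ /andP[-> _] _.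
  left; case: C RC => [|d C] /=; rewrite ?row_above_nil // row_above_cons.
  by case/andP.
- rewrite !row_above_cons ltnS => /andP[-> RC] sA /andP[_ A0x] cx.
  by case: (IH _ RC sA A0x cx) => [->|[-> ->]]; [left|right].
Qed.

Lemma split_find x R : sorted ltn R -> ~~ all (fun y => y <= x) R ->
  exists A y B, [/\ R = A ++ y :: B, find (ltn x) R = size A,
                    all (fun y => y <= x) A & x < y].
Proof.
elim: R => //= r R IH; case: (leqP r x) => [rx|xr] /= sR nR.
  have [A [y [B [eR fR Ax xy]]]] := IH (path_sorted sR) nR.
  by exists (r :: A), y, B; split; rewrite /= ?rx ?eR // -fR eR.
by exists [::], r, R.
Qed.

Lemma nth_size_cat A y B : nth 0 (A ++ y :: B) (size A) = y.
Proof. by rewrite nth_cat ltnn subnn. Qed.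

Lemma set_nth_size_cat A y B x :
  set_nth 0 (A ++ y :: B) (size A) x = A ++ x :: B.
Proof. by elim: A => //= a A ->. Qed.

Lemma row_word_rcons U R : row_word (rcons U R) = R ++ row_word U.
Proof. by rewrite /row_word rev_rcons. Qed.

Lemma row_word_cons R D : row_word (R :: D) = row_word D ++ R.
Proof. by rewrite /row_word rev_cons flatten_rcons. Qed.

Lemma row_word_cat U D : row_word (U ++ D) = row_word D ++ row_word U.
Proof. by rewrite /row_word rev_cat flatten_cat. Qed.

(* What is known of the row R when x has just been bumped, at the column of c,
   out of the row above R: after the bump that column contains c, with c = x
   exactly when the row above was left unchanged. *)
Definition bumped_above U x R : Prop :=
  U <> [::] -> exists A0 c B0,
    [/\ last [::] U = A0 ++ c :: B0, all (gtn x) A0, c <= x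
      & size A0 < size R -> x < nth 0 R (size A0)].

(** By [increasing_behead] only the row above can obstruct, and by [row_above_behead] it does so
    through an x right above the new place. The conclusion collects the hypotheses of
    [BlockedRows]. *)
Lemma blocked_row U D A C x :
  increasing_tableau (U ++ (A ++ C) :: D) ->
  0 < x -> all (gtn x) A -> all (ltn x) C -> bumped_above U x (A ++ C) ->
  ~~ increasing_tableau (U ++ (A ++ x :: behead C) :: D) ->
  exists U' A0 B0, [/\ U = rcons U' (A0 ++ x :: B0), size A = size A0,
    all (fun c => c.1 < c.2) (zip A0 A), sorted ltn (rcons A0 x)
    & sorted ltn (rcons A x)].
Proof.
move=> inc x0 Ax xC bump; move: inc; rewrite !increasing_cat_cons.
case/and3P=> incU fit incD; rewrite incU (increasing_behead incD) //= andbT.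
case/lastP: U fit bump incU => [|U R0] //.
have nU : rcons U R0 <> [::] by case: (U).
rewrite /above_ok !last_rcons (introF eqP nU) /= => fit bump incU.
have /bump[A0 [c [B0 []]]] := nU; rewrite last_rcons => eR0 A0x cx next.
(* A bumped letter never moves to the right: the entry of R in its old column, if any, exceeds x,
   while A is below x. *)
have leA : size A <= size A0.
  rewrite leqNgt; apply/negP => ltA.
  have := next; rewrite size_cat ltn_addr // nth_cat ltA => /(_ isT).
  by rewrite ltnNge ltnW //; apply: (allP Ax); rewrite mem_nth.
subst R0.
case: (row_above_behead fit leA A0x cx) => [-> //|[ec sA] _].
subst c.
exists U, A0, B0; split=> //.
- by move: fit; rewrite /row_above zip_cat // all_cat => /and3P[].
- move: incU; rewrite -cats1 increasing_cat_cons increasing_cons sorted_ltn_cat.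
  by rewrite sorted_ltn_rcons A0x => /and5P[_ _ _ _ /andP[/and3P[]]].
- move: incD; rewrite increasing_cons sorted_ltn_cat sorted_ltn_rcons Ax.
  by case/and5P=> _ _ /and3P[].
Qed.

(** Induction on D, the current row passing to U. When a letter y is bumped, a word lemma moves it
    in front of the row left behind, where the induction hypothesis for the rows below expects
    it. *)
Theorem row_word_hecke_from U D x :
  0 < x -> increasing_tableau (U ++ D) -> bumped_above U x (head [::] D) ->
  row_word (hecke_from U D x) ==k row_word D ++ x :: row_word U.
Proof.
elim: D U x => [|R D IH] U x x0 inc bump /=.
  rewrite cats0 in inc.
  case: ifPn => [_|blocked]; first by rewrite row_word_rcons.
  case/lastP: U => [|U R0] in inc bump blocked *.
    by move: blocked; rewrite /= /increasing_tableau /= x0.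
  move: blocked; rewrite -cats1 increasing_cat_cons inc increasing_cons /= x0.
  have nU : rcons U R0 <> [::] by case: (U).
  have /bump[A0 [c [B0 []]]] := nU; rewrite /above_ok last_rcons => -> A0x cx _.
  (* An empty row is the case of empty A and C. If it is blocked, the row above begins with x and
     the two copies merge. *)
  case: (@row_above_behead [::] A0 [::] c B0 x (row_above_nil _) isT A0x cx) => [->|[-> /esym/size0nil->]].
    by rewrite orbT.
  by move=> _; rewrite row_word_rcons /= kk_xx.
case: ifPn => [Rx|nRx].
  case: ifPn => [_|blocked].
    by rewrite row_word_cat !row_word_cons -cats1 -!catA.
  rewrite row_word_cat !row_word_cons -!catA.
  case/lastP: R => [|R a] in inc bump Rx blocked *.
    by move: inc; rewrite increasing_cat_cons increasing_cons /= !andbF.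
  (* If R ends in x, the two adjacent copies merge. Otherwise all of R is below x, and the row above
     has blocked the appending. *)
  move: (Rx); rewrite all_rcons leq_eqVlt => /andP[/predU1P[->|ax] _].
    by rewrite -cats1 -!catA /= kk_xx.
  have allx : all (gtn x) (rcons R a).
    rewrite all_rcons /= ax; move: inc.
    rewrite increasing_cat_cons increasing_cons sorted_ltn_rcons.
    case/and5P=> _ _ _ _ /andP[/andP[Ra _] _].
    by apply: sub_all Ra => b /= ba; apply: ltn_trans ax.
  have [||||||U' [A0 [B0 [-> sA lt_A0 A0x Ax]]]] :=
      @blocked_row U D (rcons R a) [::] x; rewrite ?cats0 ?cats1 //.
  by rewrite row_word_rcons -!catA /= -(cat_rcons x (rcons R a)) (blocked_append sA lt_A0).
have sR : sorted ltn R.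
  by move: inc; rewrite increasing_cat_cons increasing_cons => /and5P[_ _ _ _ /andP[]].
have [A [y [B [eR -> Ax xy]]]] := split_find sR nRx.
rewrite {R}eR in inc bump sR {nRx} *.
rewrite nth_size_cat set_nth_size_cat.
have y0 : 0 < y by apply: ltn_trans xy.
(* This becomes the last clause of [bumped_above] for the next row. *)
have below : size A < size (head [::] D) -> y < nth 0 (head [::] D) (size A).
  move: inc; rewrite increasing_cat_cons increasing_cons.
  case/and5P=> _ _ _ _ /and3P[_ AD _] ltA.
  by have := row_above_nth AD ltA; rewrite nth_size_cat.
have Ay : all (gtn y) A by apply: sub_all Ax => a /= /leq_ltn_trans; apply.
have xB : all (ltn x) (y :: B).
  move: sR; rewrite sorted_ltn_cat /= xy => /and3P[_ _].
  rewrite (path_sortedE ltn_trans) => /andP[yB _].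
  by apply: sub_all yB => b; apply: ltn_trans.
case: ifPn => [inc'|blocked].
  rewrite IH // ?cat_rcons //; last first.
    move=> _; exists A, x, B; rewrite last_rcons; by split=> //; apply: ltnW.
  have : sorted ltn (A ++ x :: B).
    move: inc'; rewrite increasing_cat_cons increasing_cons.
    by case/and5P=> _ _ _ _ /andP[].
  rewrite sorted_ltn_cat allrel_consr => /and3P[/andP[Alt _] _ _].
  by rewrite row_word_rcons row_word_cons -!catA /= (bump_row _ sR).
rewrite IH // ?cat_rcons //; last first.
  move=> _; exists A, y, B; by rewrite last_rcons.
rewrite row_word_rcons row_word_cons -!catA /=.
(* A replacement is blocked either by the row above, when A is below x, or because A ends in x. *)
case: (boolP (all (gtn x) A)) => [Alt|].
  have [||||||U' [A0 [B0 [-> sA lt_A0 A0x Ax']]]] :=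
      @blocked_row U D A (y :: B) x; rewrite //.
  by rewrite row_word_rcons -!catA /= (blocked_bump sA lt_A0).
case/lastP: A => [|A a] // in inc bump sR Ax Ay blocked below *.
rewrite all_rcons => nAlt.
have ea : a = x.
  apply/eqP; move: Ax nAlt; rewrite all_rcons leq_eqVlt.
  case/andP=> /predU1P[-> //|ax] _; rewrite /= ax => /negP[].
  move: sR; rewrite -cats1 -catA sorted_ltn_cat allrel_consr.
  case/and3P=> /andP[Aa _] _ _.
  by apply: sub_all Aa => b /= ba; apply: ltn_trans ax.
by rewrite ea bump_row_containing // -ea.
Qed.

(** * Inserting the row word of a tableau *)

(* The tableau obtained from R :: T by deleting the entries of R from column k
   on and moving the rest of these columns up by one box: the state reached when
   the first k letters of R have been inserted into T. *)
Fixpoint shift_up k R T : seq (seq nat) :=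
  match T with
  | [::] => if take k R is [::] then [::] else [:: take k R]
  | R' :: T' => (take k R ++ drop k R') :: shift_up k R' T'
  end.

Lemma shift_up0 R T : shift_up 0 R T = T.
Proof. by elim: T R => [|S T IH] R /=; rewrite ?take0 // IH drop0. Qed.

Lemma shift_up_oversize k R T :
  size R <= k -> increasing_tableau (R :: T) -> shift_up k R T = R :: T.
Proof.
elim: T R => [|S T IH] R Rk; rewrite increasing_cons => /and5P[R0 _ _ RS incT] /=.
  by rewrite take_oversize //; case: R R0 {Rk RS}.
have Sk : size S <= k by apply: leq_trans Rk; case/andP: RS.
by rewrite take_oversize // drop_oversize // cats0 IH.
Qed.

Lemma row_above_shift k Q R S :
  row_above Q R -> row_above R S ->
  row_above (take k Q ++ drop k R) (take k R ++ drop k S).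
Proof.
elim: k Q R S => [|k IH] [|q Q] [|r R] [|s S] //=; rewrite ?take0 ?drop0 //.
  rewrite !row_above_cons => /andP[-> QR] _; exact: IH QR (row_above_nil _).
by rewrite !row_above_cons => /andP[-> QR] /andP[_ RS]; apply: IH.
Qed.

(** The inserted letter replaces the entry of the next row S in column k. That entry is in turn the
    letter to be inserted into [shift_up k S T], so the recursion keeps k and puts S in place of
    R. *)
Lemma hecke_from_shift_up U k R T :
  k < size R -> increasing_tableau (R :: T) ->
  increasing_tableau (U ++ shift_up k R T) ->
  above_ok U (take k.+1 R ++ drop k.+1 (head [::] T)) ->
  hecke_from U (shift_up k R T) (nth 0 R k) = U ++ shift_up k.+1 R T.
Proof.
elim: T U R => [|S T IH] U R kR;
  rewrite increasing_cons => /and5P[_ R1 sR RS incT].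
all: set x := nth 0 R k; have x0 : 0 < x by apply: (allP R1); rewrite mem_nth.
all: have eR : take k.+1 R = rcons (take k R) x by rewrite (take_nth 0).
all: have Rx : all (gtn x) (take k R).
1,3: by have := take_sorted k.+1 sR; rewrite eR sorted_ltn_rcons => /andP[].
all: have leRx : all (fun y => y <= x) (take k R) by apply: sub_all Rx => y /ltnW.
  rewrite /= cats0 eR; case: (take k R) Rx leRx => [|a A] /= Rx leRx.
    rewrite cats0 cats1 => incU fit.
    by rewrite -cats1 increasing_cat_cons incU fit increasing_cons /= x0.
  rewrite leRx => incU fit.
  have -> : increasing_tableau (U ++ [:: a :: rcons A x]) = true; last by [].
  move: incU; rewrite !increasing_cat_cons fit -cats1 => /and3P[-> _ incA] /=.
  by apply: (@increasing_behead (a :: A) [::] [::] x); rewrite ?cats0.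
rewrite /= eR; case: (ltnP k (size S)) => [kS|Sk].
  rewrite (drop_nth 0 kS); set s := nth 0 S k.
  have xs : x < s by apply: row_above_nth.
  have sS : sorted ltn S by move: incT; rewrite increasing_cons => /and5P[].
  have xS : all (ltn x) (s :: drop k.+1 S).
    have := drop_sorted k sS; rewrite (drop_nth 0 kS) /= (path_sortedE ltn_trans).
    case/andP=> sdrop _; rewrite xs; apply: sub_all sdrop => y.
    exact: ltn_trans.
  rewrite all_cat /= [s <= x]leqNgt xs andbF find_cat /= xs addn0.
  rewrite (_ : has _ _ = false); last first.
    by apply/hasPn => y /(allP Rx) /= yx; rewrite -leqNgt ltnW.
  rewrite nth_size_cat set_nth_size_cat cat_rcons => incU fit.
  have -> : increasing_tableau
      (U ++ (take k R ++ x :: drop k.+1 S) :: shift_up k S T) = true.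
    move: incU; rewrite !increasing_cat_cons fit => /and3P[-> _ incA] /=.
    exact: increasing_behead incA _ _ xS.
  rewrite IH ?cat_rcons //; last first.
    rewrite /above_ok last_rcons -cat_rcons -eR row_above_shift ?orbT //.
    by move: incT; rewrite increasing_cons => /and5P[].
  move: incU; rewrite !increasing_cat_cons fit => /and3P[-> _ incA] /=.
  exact: increasing_behead incA _ _ xS.
(* S has no entry in column k, so x is appended and the rows below are already in place. *)
rewrite !drop_oversize ?(leq_trans Sk) // !cats0 leRx => incU fit.
rewrite !shift_up_oversize ?(leq_trans Sk) // in incU *.
have -> // : increasing_tableau (U ++ rcons (take k R) x :: S :: T) = true.
move: incU; rewrite !increasing_cat_cons fit -cats1 => /and3P[-> _ incA] /=.
by apply: (@increasing_behead _ [::] _ x); rewrite ?cats0.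
Qed.

Lemma hecke_insert_row R T :
  increasing_tableau (R :: T) -> foldl hecke_insert T R = R :: T.
Proof.
move=> incRT; have incT : increasing_tableau T.
  by move: incRT; rewrite increasing_cons => /and5P[].
suff insert k : k <= size R -> foldl hecke_insert T (take k R) = shift_up k R T /\
                               increasing_tableau (shift_up k R T).
  by have [] := insert _ (leqnn _); rewrite take_size shift_up_oversize.
elim: k => [|k IH] kR; first by rewrite take0 shift_up0.
have [eT inck] := IH (ltnW kR).
have ek : hecke_insert (shift_up k R T) (nth 0 R k) = shift_up k.+1 R T.
  exact: (@hecke_from_shift_up [::]).
split; first by rewrite (take_nth 0) // foldl_rcons eT.
by rewrite -ek; apply: hecke_from_increasing.
Qed.

Theorem hecke_insert_row_word T :
  increasing_tableau T -> foldl hecke_insert [::] (row_word T) = T.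
Proof.
elim: T => [|R T IH] // incRT.
rewrite row_word_cons foldl_cat IH ?hecke_insert_row //.
by move: incRT; rewrite increasing_cons => /and5P[].
Qed.

Theorem row_word_hecke_insert T x :
  0 < x -> increasing_tableau T -> row_word (hecke_insert T x) ==k rcons (row_word T) x.
Proof.
by move=> x0 incT; rewrite -cats1; apply: (@row_word_hecke_from [::]).
Qed.
End Shapes.

(** * Partitions and runs of the algorithm *)

Section Partitions.
Variable n : nat.
Implicit Types (P : {set {set tab n}}) (s : state n) (U V T : tab n).
Implicit Types (p : tab n * tab n) (E : tab n -> tab n -> Prop).

Definition full_partition P := trivIset P && (cover P == [set: tab n]).

Lemma joined_of_mem P B U V : B \in P -> U \in B -> V \in B -> joined P U V.
Proof. by move=> BP UB VB; apply/existsP; exists B; rewrite BP UB. Qed.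

Lemma joined_equivalence P :
  full_partition P -> Equivalence (fun U V => joined P U V).
Proof.
case/andP=> tP /eqP cP.
have inP T : T \in pblock P T by rewrite mem_pblock cP.
have PB T : pblock P T \in P by rewrite pblock_mem // cP.
split=> [U|U V|U V T].
- exact: joined_of_mem (PB U) (inP U) (inP U).
- by case/existsP=> B /and3P[BP UB VB]; apply: joined_of_mem BP VB UB.
- case/existsP=> B /and3P[BP UB VB] /existsP[C /and3P[CP VC TC]].
  apply: (joined_of_mem BP UB).
  by rewrite -(def_pblock tP BP VB) (def_pblock tP CP VC).
Qed.

Lemma full_partition_process s p :
  full_partition s.1 -> full_partition (process s p).1.
Proof.
case/andP=> tP /eqP cP; rewrite /full_partition (process_measure p cP).1 eqxx andbT.
have PB T : pblock s.1 T \in s.1 by rewrite pblock_mem // cP.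
rewrite /process; case: ifP => //= _.
have disj B : B \in s.1 :\: [set pblock s.1 p.1; pblock s.1 p.2] ->
    [disjoint B & pblock s.1 p.1 :|: pblock s.1 p.2].
  rewrite !inE negb_or -andbA => /and3P[B1 B2 BP].
  rewrite -setI_eq0 setIUr setU_eq0 !setI_eq0.
  by apply/andP; split; apply: (trivIsetP tP); rewrite ?PB.
apply/trivIsetP => B C /setU1P[->|BP] /setU1P[->|CP]; rewrite ?eqxx //.
- by move=> _; rewrite disjoint_sym disj.
- by move=> _; rewrite disj.
- by move: BP CP => /setDP[BP _] /setDP[CP _]; apply: (trivIsetP tP).
Qed.

Lemma process_mono s p U V : joined s.1 U V -> joined (process s p).1 U V.
Proof.
rewrite /process; case: ifP => //= _ /existsP[B /and3P[BP UB VB]].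
case: (boolP (B \in [set pblock s.1 p.1; pblock s.1 p.2])) => nB.
  apply: (@joined_of_mem _ (pblock s.1 p.1 :|: pblock s.1 p.2)).
  - exact: setU11.
  - by move: nB UB; rewrite !inE => /orP[]/eqP-> ->; rewrite ?orbT.
  - by move: nB VB; rewrite !inE => /orP[]/eqP-> ->; rewrite ?orbT.
by apply: joined_of_mem UB VB; rewrite inE in_setD nB BP orbT.
Qed.

Lemma process_joined s p :
  full_partition s.1 -> joined (process s p).1 p.1 p.2.
Proof.
case/andP=> _ /eqP cP; have inP T : T \in pblock s.1 T by rewrite mem_pblock cP.
rewrite /process; case: ifP => //= _; apply: joined_of_mem (setU11 _ _) _ _.
  by rewrite inE inP.
by rewrite inE inP orbT.
Qed.

(** Serves both directions: E is K-Knuth equivalence for soundness and [joined_after_insertion] for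
    stability. E is tested on p only when a merge happens, which is exactly when p enters the
    queue. *)
Lemma process_least s p E : full_partition s.1 -> Equivalence E ->
  (forall U V, joined s.1 U V -> E U V) ->
  (~~ joined s.1 p.1 p.2 -> E p.1 p.2) ->
  forall U V, joined (process s p).1 U V -> E U V.
Proof.
case/andP=> _ /eqP cP eqE sE pE U V; rewrite /process.
case: ifPn => [_|/pE Ep] //=; first exact: sE.
case/existsP=> B /andP[]; rewrite !inE.
have inE1 T T' : T' \in pblock s.1 T -> E T T'.
  move=> T'T; apply: sE; apply: joined_of_mem (pblock_mem _) _ T'T => //.
    by rewrite cP.
  by rewrite mem_pblock cP.
case/predU1P=> [->|/andP[_ BP] /andP[UB VB]]; last by apply: sE; apply: joined_of_mem BP UB VB.
rewrite !inE => /andP[/orP[]/inE1 EU /orP[]/inE1 EV].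
all: rewrite -EU -EV; first [reflexivity | exact: Ep | symmetry; exact: Ep].
Qed.

Lemma mem_queue_process s p q : q \in s.2 -> q \in (process s p).2.
Proof.
by rewrite /process; case: ifP => //= _ qs; rewrite mem_rcons inE qs orbT.
Qed.

(** * Invariants along a run *)

Definition run s (l : seq (tab n * tab n)) := foldl (@process n) s l.

Lemma full_partition_run s l : full_partition s.1 -> full_partition (run s l).1.
Proof. by elim: l s => //= p l IH s /(full_partition_process p)/IH. Qed.

Lemma run_mono s l U V : joined s.1 U V -> joined (run s l).1 U V.
Proof. by elim: l s => //= p l IH s /(process_mono p)/IH. Qed.

Lemma run_joined s l p :
  full_partition s.1 -> p \in l -> joined (run s l).1 p.1 p.2.
Proof.
elim: l s => //= q l IH s fs /predU1P[->|pl].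
  exact: run_mono (process_joined _ fs).
exact: IH (full_partition_process _ fs) pl.
Qed.

Definition sound_for E s : Prop :=
  (forall U V, joined s.1 U V -> E U V) /\ (forall q, q \in s.2 -> E q.1 q.2).

Lemma sound_for_run E s l : full_partition s.1 -> Equivalence E ->
  sound_for E s -> (forall p, p \in l -> E p.1 p.2) -> sound_for E (run s l).
Proof.
move=> + eqE; elim: l s => //= p l IH s fs [sE qE] lE.
apply: IH => [||q ql]; first exact: full_partition_process.
  split; first by apply: process_least => // _; apply: lE; rewrite mem_head.
  rewrite /process; case: ifP => //= _ q; rewrite mem_rcons inE.
  by case/predU1P=> [->|/qE //]; apply: lE; rewrite mem_head.
by apply: lE; rewrite inE ql orbT.
Qed.

(* Taking for E the relation U <- y and V <- y are joined, for all y, this is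
   the invariant which guarantees that, once the queue is empty, the final
   partition is stable under insertion. *)
Definition generated_by_queue E s : Prop :=
  (forall q, q \in s.2 -> E q.1 q.2) -> forall U V, joined s.1 U V -> E U V.

Lemma generated_by_queue_run E s l : full_partition s.1 -> Equivalence E ->
  generated_by_queue E s -> generated_by_queue E (run s l).
Proof.
move=> + eqE; elim: l s => //= p l IH s fs gs.
apply: IH; first exact: full_partition_process.
move=> qE; apply: process_least => //.
  by apply: gs => q /(mem_queue_process p)/qE.
by move=> nj; apply: qE; rewrite /process (negPf nj) mem_rcons mem_head.
Qed.

Lemma stage2_mono s Pend : stage2 s Pend -> full_partition s.1 ->
  full_partition Pend /\ forall U V, joined s.1 U V -> joined Pend U V.
Proof.
elim=> {s Pend} //= P Q U Q' ys Pend _ _ _ IH fP.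
have [fend mono] := IH (@full_partition_run (P, Q') _ fP).
by split=> // V T VT; apply/mono/run_mono.
Qed.

Lemma stage2_sound E s Pend : Equivalence E ->
  (forall U V y, E U V -> E (tab_insert U y) (tab_insert V y)) ->
  stage2 s Pend -> full_partition s.1 -> sound_for E s ->
  forall U V, joined Pend U V -> E U V.
Proof.
move=> eqE insE; elim=> {s Pend} [P _ []//|P Q U Q' ys Pend pQ _ _ IH fP [sE qE]].
apply: IH; first exact: (@full_partition_run (P, Q')).
apply: sound_for_run => //.
  by split=> // q qQ'; apply: qE; rewrite /= (perm_mem pQ) inE qQ' orbT.
move=> _ /mapP[y _ ->]; apply: insE; apply: qE.
by rewrite /= (perm_mem pQ) mem_head.
Qed.

Definition joined_after_insertion P U V : Prop :=
  forall y, joined P (tab_insert U y) (tab_insert V y).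

Lemma joined_after_insertion_equivalence P :
  full_partition P -> Equivalence (joined_after_insertion P).
Proof.
move=> /joined_equivalence eqP; split=> [U y|U V UV y|U V T UV VT y].
- by reflexivity.
- by symmetry; apply: UV.
- by transitivity (tab_insert V y); [apply: UV|apply: VT].
Qed.

(** The relation refers to the final partition, so it stays fixed during the run. A pair leaving the
    queue satisfies it: its images under all letters are processed at once and remain joined. When
    the queue is empty, the invariant is the claim. *)
Lemma stage2_stable s Pend : stage2 s Pend -> full_partition s.1 ->
  generated_by_queue (joined_after_insertion Pend) s ->
  forall U V, joined Pend U V -> joined_after_insertion Pend U V.
Proof.
elim=> {s Pend} [P _|P Q U Q' ys Pend pQ pys st IH fP gP]; first by apply.
have fQ' := @full_partition_run (P, Q') (insert_letters U ys) fP.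
have [fend mono] := stage2_mono st fQ'.
apply: IH => //; apply: generated_by_queue_run => //.
  exact: joined_after_insertion_equivalence.
move=> Q'E; apply: gP => q; rewrite /= (perm_mem pQ) inE.
case/predU1P=> [-> y|/Q'E //]; apply: mono.
apply: (run_joined (p := (tab_insert U.1 y, tab_insert U.2 y))) => //.
by apply/mapP; exists y; rewrite // (perm_mem pys) mem_enum.
Qed.

Lemma joined_initial U V : joined (initial_state n).1 U V = (U == V).
Proof.
apply/existsP/eqP => [[_ /andP[/imsetP[T _ ->]]]|->].
  by rewrite !inE => /andP[/eqP-> /eqP].
by exists [set V]; rewrite imset_f // inE eqxx.
Qed.

Lemma full_partition_initial : full_partition (initial_state n).1.
Proof.
apply/andP; split.
  apply/trivIsetP => _ _ /imsetP[T _ ->] /imsetP[T' _ ->] TT'.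
  by rewrite disjoints1 inE; apply: contraNneq TT' => ->.
apply/eqP/setP => T; rewrite inE; apply/bigcupP.
by exists [set T]; rewrite ?set11 ?imset_f.
Qed.

End Partitions.

(** * Correctness *)

Section Correctness.
Variable n : nat.
Implicit Types (T U V : tab n) (w : seq (letter n)) (P : {set {set tab n}}).

Definition word_of w : seq nat := [seq val (letter_val y) | y <- w].

Lemma rows_tab_insert_word T w :
  rows (tab_insert_word T w) = foldl hecke_insert T (word_of w).
Proof. by elim: w T => //= y w IH T; rewrite IH. Qed.

Lemma row_word_tab_insert_word T w :
  row_word (tab_insert_word T w) ==k row_word T ++ word_of w.
Proof.
elim: w T => [|y w IH] T /=; first by rewrite cats0.
rewrite IH row_word_hecke_insert ?cat_rcons //; first exact: letter_gt0.
by case/andP: (rowsP T).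
Qed.

Lemma primitive_pair_equiv (a b : seq (letter n)) :
  primitive_pair a b -> word_of a ==k word_of b.
Proof.
case=> [p|p q _|x y z xy yz|x y z xy yz] /=.
- by rewrite kk_xx.
- by rewrite kk_xyx.
- by rewrite (kk_xzy _ xy yz).
- by rewrite (kk_yxz _ xy yz).
Qed.

#[local] Instance K_Knuth_equiv_tab_equivalence :
  Equivalence (fun U V => K_Knuth_equiv_tab U V).
Proof.
rewrite /K_Knuth_equiv_tab; split=> [U|U V|U V T] //; first exact: symmetry.
exact: transitivity.
Qed.

Lemma algorithm_sound P U V :
  algorithm_output P -> joined P U V -> K_Knuth_equiv_tab U V.
Proof.
case=> o [_ ho] st; move: U V.
have fp := full_partition_initial n.
apply: (stage2_sound K_Knuth_equiv_tab_equivalence _ st); last 2 first.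
- exact: (full_partition_run _ fp).
- apply: sound_for_run => // [|_ /mapP[[T [a b]] /ho ab ->]].
    split=> // U V; rewrite joined_initial => /eqP->.
    by rewrite /K_Knuth_equiv_tab.
  rewrite /K_Knuth_equiv_tab !row_word_tab_insert_word.
  by rewrite (primitive_pair_equiv ab).
- move=> U V y; rewrite /K_Knuth_equiv_tab => UV.
  have /= -> := row_word_tab_insert_word U [:: y].
  have /= -> := row_word_tab_insert_word V [:: y].
  by rewrite UV.
Qed.

(** * Equivalent tableaux end up joined *)

Section Completeness.
Variable P : {set {set tab n}}.
Hypothesis P_output : algorithm_output P.

Lemma output_partition : full_partition P.
Proof.
case: P_output => o _ st.
by have [] := stage2_mono st (full_partition_run _ (full_partition_initial n)).
Qed.

#[local] Instance output_equivalence : Equivalence (fun U V => joined P U V) :=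
  joined_equivalence output_partition.

Lemma output_primitive T a b :
  primitive_pair a b -> joined P (tab_insert_word T a) (tab_insert_word T b).
Proof.
have fp := full_partition_initial n.
case: P_output => o [_ ho] st ab.
have [_ mono] := stage2_mono st (full_partition_run _ fp); apply: mono.
apply: (run_joined (p := (tab_insert_word T a, tab_insert_word T b)) fp).
by apply/mapP; exists (T, (a, b)); rewrite // ho.
Qed.

Lemma output_insert_word U V w :
  joined P U V -> joined P (tab_insert_word U w) (tab_insert_word V w).
Proof.
have fp := full_partition_initial n.
have insP : forall U V, joined P U V -> joined_after_insertion P U V.
  case: P_output => o _ st; apply: (stage2_stable st).
    exact: (full_partition_run _ fp).
  (* The invariant holds before stage 1, when joined tableaux are equal, and stage 1 preserves
     it. *)
  apply: generated_by_queue_run => //.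
    exact: joined_after_insertion_equivalence output_partition.
  by move=> _ U' V'; rewrite joined_initial => /eqP-> y; reflexivity.
by elim: w U V => //= y w IH U V UV; apply/IH/insP.
Qed.

Hypothesis n_gt0 : 0 < n.

Fact letter1_subproof : 0 < (inord 1 : 'I_n.+1).
Proof. by rewrite inordK. Qed.

(** Numbers outside [n] are sent to the letter 1, which exists because n is positive. *)
Definition to_letter (x : nat) : letter n :=
  insubd (Letter letter1_subproof) (inord x : 'I_n.+1).

Lemma to_letterK x : 0 < x <= n -> to_letter x = x :> nat.
Proof.
case/andP=> x0 xn; rewrite /to_letter val_insubd.
by rewrite inordK ?x0 ?ltnS //= inordK.
Qed.

Definition tab_of_word (s : seq nat) : tab n :=
  tab_insert_word (@Tab n [::] isT) (map to_letter s).

Definition word_in_n (s : seq nat) := all (fun x => 0 < x <= n) s.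

Lemma word_of_to_letter s : word_in_n s -> word_of (map to_letter s) = s.
Proof.
move=> /allP sn; rewrite /word_of -map_comp -[RHS]map_id.
by apply/eq_in_map => x /sn /to_letterK.
Qed.

Lemma word_in_n_row_word T : word_in_n (row_word T).
Proof.
case/andP: (rowsP T) => /and4P[_ /allP T1 _ _] /allP Tn.
apply/allP => x /flattenP[R]; rewrite mem_rev => RT xR.
by rewrite (allP (T1 _ RT)) // (allP (Tn _ RT)).
Qed.

Lemma tab_of_row_word T : tab_of_word (row_word T) = T.
Proof.
apply: val_inj; rewrite /= rows_tab_insert_word word_of_to_letter.
  by apply: hecke_insert_row_word; case/andP: (rowsP T).
exact: word_in_n_row_word.
Qed.

(** Inserting u gives a tableau to which stage 1 has applied the primitive pair; stability under
    insertion then takes care of v. The first conjunct keeps a whole chain of moves inside [n]. *)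
Lemma joined_of_move s t : K_Knuth_move s t ->
  word_in_n s = word_in_n t /\
  (word_in_n s -> joined P (tab_of_word s) (tab_of_word t)).
Proof.
have context u v a b : primitive_pair (map to_letter a) (map to_letter b) ->
    joined P (tab_of_word (u ++ a ++ v)) (tab_of_word (u ++ b ++ v)).
  move=> ab; rewrite /tab_of_word !map_cat /tab_insert_word !foldl_cat.
  by apply: output_insert_word; apply: output_primitive.
rewrite /word_in_n.
case=> [u v x y z xy yz|u v x y z xy yz|u v x|u v x y]; rewrite !all_cat /=.
- split.
    by congr (_ && _); case: (0 < x <= n); case: (0 < y <= n); case: (0 < z <= n).
  case/and3P=> _ /and4P[xn zn yn _] _.
  apply: (context u v [:: x; z; y] [:: z; x; y]).
  by apply: Prim_xzy; rewrite !to_letterK.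
- split.
    by congr (_ && _); case: (0 < x <= n); case: (0 < y <= n); case: (0 < z <= n).
  case/and3P=> _ /and4P[yn xn zn _] _.
  apply: (context u v [:: y; x; z] [:: y; z; x]).
  by apply: Prim_yxz; rewrite !to_letterK.
- split; first by rewrite !andbT andbb.
  by move=> _; apply: (context u v [:: x] [:: x; x]); apply: Prim_pp.
- split.
    by congr (_ && _); case: (0 < x <= n); case: (0 < y <= n).
  (* [KK_xyx] allows x = y, whereas the primitive pair requires distinct letters. *)
  case/and3P=> _ /and4P[xn yn _ _] _; have [->|xy] := eqVneq x y.
    by reflexivity.
  apply: (context u v [:: x; y; x] [:: y; x; y]).
  apply: Prim_pqp; apply: contraNneq xy => exy.
  by rewrite -(to_letterK xn) exy to_letterK.
Qed.

Lemma joined_of_equiv s t : s ==k t ->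
  word_in_n s = word_in_n t /\
  (word_in_n s -> joined P (tab_of_word s) (tab_of_word t)).
Proof.
elim=> {s t} [s t /joined_of_move //|s|s t _ [e st]|s t r _ [e1 st] _ [e2 tr]].
- by split=> // _; reflexivity.
- by split=> // tn; symmetry; apply: st; rewrite e.
- split=> [|sn]; first by rewrite e1.
  by transitivity (tab_of_word t); [apply: st|apply: tr; rewrite -e1].
Qed.

Lemma algorithm_complete U V : K_Knuth_equiv_tab U V -> joined P U V.
Proof.
case/joined_of_equiv => _ /(_ (word_in_n_row_word U)).
by rewrite !tab_of_row_word.
Qed.

End Completeness.
End Correctness.

Theorem theorem3p1 (n : nat) (n_gt0 : 0 < n)
    (Pend : {set {set tab n}}) (Pend_output : algorithm_output Pend)
    (T1 T2 : tab n) :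
  K_Knuth_equiv_tab T1 T2 <-> joined Pend T1 T2.
Proof.
split; first exact: algorithm_complete.
exact: algorithm_sound.
Qed.
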